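(* Let $n\ge 1$ be an integer and let $T>0$ be a real number. Let $P$ be the transition matrix of the (random-scan) Gibbs sampler for the two-dimensional $n\times n$ Ising model with two states $\pm1$, free boundary condition and temperature $T$, and let $\beta^*=\max\{\beta_1,|\beta_{|\chi|-1}|\}$ be its second largest eigenvalue in absolute value. Then $$\beta^* \le 1 - n^{-4}\exp\Big\{-\tfrac{2}{T}(2n+1)\Big\}.$$
   Context: State space: $\chi=\{-1,1\}^{n^2}$, whose elements are written $x=(x^j_i)_{1\le i,j\le n}$. Ising distribution on $\chi$ (free boundary condition, temperature $T>0$): $$\pi(x)=\frac{1}{Z_T}\exp\Big\{\tfrac1T\Big(\sum_{j=1}^{n}\sum_{i=1}^{n-1}x^j_i x^j_{i+1}+\sum_{i=1}^{n}\sum_{j=1}^{n-1}x^j_i x^{j+1}_i\Big)\Big\},$$ where $Z_T$ is the normalizing constant making $\pi$ a probability measure on $\chi$. For $x,y\in\chi$, $d(x,y)$ denotes the number of sites $(i,j)\in\{1,\dots,n\}^2$ with $x^j_i\ne y^j_i$. For $x\in\chi$, a site $(i,j)$ and $s\in\{-1,1\}$, let $x^{(i,j)\to s}$ be the configuration that equals $s$ at site $(i,j)$ and agrees with $x$ at all other sites, and let $$\pi_{i,j}(s\mid x)=\frac{\pi(x^{(i,j)\to s})}{\pi(x^{(i,j)\to s})+\pi(x^{(i,j)\to -s})}$$ be the conditional probability of value $s$ at site $(i,j)$ given the other coordinates of $x$. Gibbs sampler (a uniformly random coordinate is updated according to its conditional distribution given the other coordinates): the transition matrix $P$ on $\chi$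 is - $P(x,y)=\frac{1}{n^2}\,\pi_{i,j}(y^j_i\mid x)$ if $d(x,y)=1$ and $(i,j)$ is the site with $x^j_i\ne y^j_i$; - $P(x,x)=1-\frac{1}{n^2}\sum_{i,j=1}^n \pi_{i,j}(-x^j_i\mid x)$; - $P(x,y)=0$ otherwise. $P$ is irreducible, aperiodic and reversible with respect to $\pi$; its eigenvalues, counted with multiplicity, are real and are arranged as $1=\beta_0>\beta_1\ge\beta_2\ge\cdots\ge\beta_{|\chi|-1}>-1$. *)

(* Defs.v *)
From mathcomp Require Import all_boot all_order all_algebra.
From mathcomp Require Import reals sequences exp.
From mathcomp Require complex.
From mathcomp Require Import ring.

Set Implicit Arguments.
Unset Strict Implicit.
Unset Printing Implicit Defensive.

Import Order.TTheory GRing.Theory Num.Theory.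

Local Open Scope ring_scope.

Definition site (n : nat) := ('I_n * 'I_n)%type.

(* The spins 1 and -1 are encoded by true and false, so that s |-> -s is negb;
   x (i, j) stands for x^j_i. *)
Definition config (n : nat) := {ffun site n -> bool}.

Definition spin (R : realType) (b : bool) : R := if b then 1 else - 1.

Section Ising.
Variables (R : realType) (n : nat) (T : R).
Implicit Types (x y : config n) (u : site n).

(* The innermost sums have at most one term: they are empty at the last
   row or column (free boundary condition). *)
Definition interaction x : R :=
  \sum_(j < n) \sum_(i < n) \sum_(i' < n | i' == i.+1 :> nat)
      spin R (x (i, j)) * spin R (x (i', j))
  + \sum_(i < n) \sum_(j < n) \sum_(j' < n | j' == j.+1 :> nat)
      spin R (x (i, j)) * spin R (x (i, j')).

Definition partition_function : R :=
  \sum_(x : config n) expR (T^-1 * interaction x).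

Definition ising x : R := partition_function^-1 * expR (T^-1 * interaction x).

Definition dist x y : nat := #|[set u | x u != y u]|.

Definition update x u (s : bool) : config n :=
  [ffun v => if v == u then s else x v].

Definition cond_prob u (s : bool) x : R :=
  ising (update x u s) / (ising (update x u s) + ising (update x u (~~ s))).

(* In the case dist x y = 1 the sum has exactly one term, at the site where
   x and y differ. *)
Definition gibbs x y : R :=
  if dist x y == 1%N then
    \sum_(u | x u != y u) (n ^ 2)%:R^-1 * cond_prob u (y u) x
  else if x == y then
    1 - (n ^ 2)%:R^-1 * \sum_(i < n) \sum_(j < n)
          cond_prob (i, j) (~~ x (i, j)) x
  else 0.

Definition gibbs_mx : 'M[R]_#|config n| :=
  \matrix_(a, b) gibbs (enum_val a) (enum_val b).

End Ising.

(* beta lists the eigenvalues of A with their algebraic multiplicities, in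
   nonincreasing order; such a list is unique and has size m, and lemma
   gibbs_spectrum below shows that it exists for the Gibbs sampler. *)
Definition is_spectrum (R : realType) (m : nat) (A : 'M[R]_m)
    (beta : seq R) : Prop :=
  char_poly A = \prod_(b <- beta) ('X - b%:P) /\ sorted >=%R beta.

Definition beta_star (R : realType) (n : nat) (beta : seq R) : R :=
  Num.max beta`_1 `|beta`_(#|config n|.-1)|.

Module SpectrumExistence.

Lemma reversible_eigenvalue_real (R : realType) (C : numClosedFieldType)
    (f : {rmorphism R -> C}) (m : nat) (A : 'M[R]_m) (w : 'I_m -> R) (z : C) :
  (forall a, 0 < a -> 0 < f a) -> (forall a, (f a)^* = f a) ->
  (forall i, 0 < w i) -> (forall i j, w i * A i j = w j * A j i) ->
  eigenvalue (map_mx f A) z -> z^* = z.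
Proof.
move=> f_gt0 fC w_gt0 wA /eigenvalueP[v vA v0].
have wf i : 0 < f (w i) by exact: f_gt0.
have Ev j : \sum_i v ord0 i * f (A i j) = z * v ord0 j.
  have /matrixP/(_ ord0 j) := vA; rewrite !mxE => <-.
  by apply: eq_bigr => i _; rewrite mxE.
pose S := \sum_j v ord0 j * (v ord0 j)^* / f (w j).
pose Q := \sum_j \sum_i v ord0 i * f (A i j) * (v ord0 j)^* / f (w j).
have QE : Q = z * S.
  rewrite /Q /S mulr_sumr; apply: eq_bigr => j _.
  by rewrite !mulrA -(Ev j) !mulr_suml.
have S0 : S != 0.
  apply: contraNneq v0 => S0; apply/eqP/rowP => j; rewrite mxE.
  have ge0 k : true -> 0 <= v ord0 k * (v ord0 k)^* / f (w k).
    by move=> _; rewrite divr_ge0 ?(ltW (wf k)) // mul_conjC_ge0.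
  have := psumr_eq0P ge0 S0 (i := j) isT.
  move/eqP; rewrite mulf_eq0 invr_eq0 (gt_eqF (wf j)) orbF mul_conjC_eq0.
  by move/eqP.
have SC : S^* = S.
  rewrite /S rmorph_sum; apply: eq_bigr => j _.
  by rewrite !rmorphM fmorphV /= conjCK fC [_^* * _]mulrC.
have QC : Q^* = Q.
  rewrite /Q rmorph_sum.
  under eq_bigr => j _ do rewrite rmorph_sum.
  rewrite exchange_big /=; apply: eq_bigr => j _; apply: eq_bigr => i _.
  rewrite !rmorphM fmorphV /= conjCK !fC.
  have wi : f (w i) != 0 by rewrite gt_eqF.
  have wj : f (w j) != 0 by rewrite gt_eqF.
  have -> : f (A j i) = f (w i) * f (A i j) / f (w j).
    by rewrite -rmorphM wA rmorphM mulrAC divff // mul1r.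
  by field; rewrite wi wj.
by apply: (mulIf S0); rewrite -QE -[in RHS]QC QE rmorphM /= SC.
Qed.

Import complex.

Lemma reversible_spectrum (R : realType) (m : nat) (A : 'M[R]_m)
    (w : 'I_m -> R) :
  (forall i, 0 < w i) -> (forall i j, w i * A i j = w j * A j i) ->
  exists beta, is_spectrum A beta.
Proof.
move=> w_gt0 wA.
pose f : {rmorphism R -> complex R} := real_complex R.
have [r Er] := closed_field_poly_normal (char_poly (map_mx f A)).
have mon := char_poly_monic (map_mx f A).
rewrite (monicP mon) scale1r in Er.
have r_real z : z \in r -> z = f (complex.Re z).
  move=> zr; have ez : eigenvalue (map_mx f A) z.
    by rewrite eigenvalue_root_char Er root_prod_XsubC.
  have : z^* = z.
    apply: reversible_eigenvalue_real w_gt0 wA ez => a.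
      by rewrite /f ltcR.
    by congr Complex; rewrite oppr0.
  case: z {zr ez} => a b [] /eqP.
  by rewrite eqNr => /eqP ->.
pose beta := sort >=%R (map (@complex.Re R) r).
exists beta; split; last by apply: sort_sorted => a b; exact: le_total.
have -> : \prod_(b <- beta) ('X - b%:P) =
          \prod_(b <- map (@complex.Re R) r) ('X - b%:P) :> {poly R}.
  by apply: perm_big; rewrite perm_sort.
apply: (map_poly_inj f); rewrite map_char_poly Er rmorph_prod big_map.
rewrite big_seq [RHS]big_seq; apply: eq_bigr => z zr.
by rewrite rmorphB /= map_polyX map_polyC /= -r_real.
Qed.

End SpectrumExistence.

Section GibbsSpectrum.
Variables (R : realType) (n : nat) (T : R).

Lemma ising_gt0 (x : config n) : 0 < ising T x.
Proof.
rewrite mulr_gt0 ?expR_gt0 // invr_gt0 /partition_function (bigD1 x) //=.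
by rewrite ltr_pwDl ?expR_gt0 // sumr_ge0 // => y _; rewrite expR_ge0.
Qed.

Lemma gibbs_reversible (x y : config n) :
  ising T x * gibbs T x y = ising T y * gibbs T y x.
Proof.
rewrite /gibbs.
have -> : dist y x = dist x y.
  by apply: eq_card => u; rewrite !inE eq_sym.
have [/eqP/cards1P[u Du]|_] := eqVneq (dist x y) 1%N; last first.
  by rewrite eq_sym; case: eqP => [->|_]; rewrite ?mulr0.
have xyu v : (x v != y v) = (v == u) by have /setP/(_ v) := Du; rewrite !inE.
have yxu v : (y v != x v) = (v == u) by rewrite eq_sym.
rewrite (eq_bigl _ _ xyu) (eq_bigl _ _ yxu) !big_pred1_eq /cond_prob.
have upx : update x u (y u) = y.
  apply/ffunP => v; rewrite ffunE; case: eqP => [->//|/eqP].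
  by rewrite -xyu negbK => /eqP.
have upy : update y u (x u) = x.
  apply/ffunP => v; rewrite ffunE; case: eqP => [->//|/eqP].
  by rewrite -xyu negbK => /eqP.
have ny : ~~ y u = x u by have := xyu u; rewrite eqxx; case: (x u) (y u) => -[].
have nx : ~~ x u = y u by rewrite -ny negbK.
have upx' : update x u (x u) = x.
  by apply/ffunP => v; rewrite ffunE; case: eqP => [->|].
have upy' : update y u (y u) = y.
  by apply/ffunP => v; rewrite ffunE; case: eqP => [->|].
rewrite nx ny upx upy upx' upy' [ising T x + _]addrC.
by rewrite mulrCA [RHS]mulrCA; congr (_ * _); rewrite mulrCA.
Qed.

Lemma gibbs_spectrum : exists beta, is_spectrum (gibbs_mx n T) beta.
Proof.
apply: (@SpectrumExistence.reversible_spectrum _ _ _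
          (fun a => ising T (enum_val a))) => [a|a b]; first exact: ising_gt0.
by rewrite !mxE gibbs_reversible.
Qed.

End GibbsSpectrum.

(* Main.v *)
Require Import Defs.
From mathcomp Require Import all_boot all_order all_algebra.
From mathcomp Require Import reals sequences exp.
From mathcomp Require Import ring lra zify.

(** The Gibbs sampler P is reversible with respect to the Ising distribution
pi and is the average over the sites of the conditional expectations
(orthogonal projections of L^2(pi)), so its eigenvalues are nonnegative
([eigenvalue_ge0]) and it remains to bound the second largest one.  As P is
stochastic, its characteristic polynomial is X - 1 times that of a smaller
matrix, all of whose eigenvalues, with multiplicity, come from eigenvectors
of P orthogonal to the constants ([char_poly_deflate],
[deflate_eigenvector]).  Hence it suffices that every such eigenvalue is at
most the claimed bound ([spectrum_stochastic]), which follows from a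
Poincare inequality for P ([poincare], [eigenvalue_gap]).

The Poincare inequality is proved with canonical paths: the sites are put in
lexicographic order and the path from x to y replaces the spins of x by those
of y one site at a time.  When the k first sites have been treated, the pair
(x, y) is encoded by the current configuration z, equal to y before k and to
x from k on, and the complementary one w, equal to x before k and to y from k
on; this is a bijection of pairs.  The congestion of the step that updates
the site u is thus governed by

  S = sum over w with w(u) <> z(u) of pi(x) pi(y),

and the key estimate is S <= 1/2 exp(3 (n + 1) / T) pi(z) ([cut_bound]).
It rests on two facts.  At most n + 1 bonds cross the cut between the k first
sites and the others ([card_cut]), so each of x, y, z has energy within n + 1
of its energy without the crossing bonds; the latter energies have the same
sum over {x, y} as over {z, w}.  For the sum over w, flipping all the spins
on one side of the cut reverses the sign of the crossing energy, so that
removing the crossing bonds does not increase the partition function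
([sum_inner_le]), and flipping all the spins shows that half of it comes from
the w with w(u) <> z(u) ([half_inner]).

Since the cuts just before and just after u yield the same sum S, it is
bounded both in terms of pi(z) and of pi(z'), where z' is z flipped at u,
hence in terms of the conductance pi(z) pi(z') / (pi(z) + pi(z'))
([congestion]).  The paths have n^2 steps and each site is updated with
probability 1 / n^2, so the spectral gap is at least
n^-4 exp(- 3 (n + 1) / T), and 3 (n + 1) <= 2 (2 n + 1) for n >= 1. *)

Set Implicit Arguments.
Unset Strict Implicit.
Unset Printing Implicit Defensive.

Import Order.TTheory GRing.Theory Num.Theory.

Local Open Scope ring_scope.

(** * Spectra of stochastic matrices *)

(** The matrix induced by A on the quotient of the column space by the vector
1 = (1, ..., 1), when A fixes that vector. *)
Definition deflate (R : comNzRingType) (m : nat) (A : 'M[R]_(1 + m)) : 'M[R]_m :=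
  drsubmx A - const_mx 1 *m ursubmx A.

(** In the basis made of 1 and of the last m canonical vectors, A becomes block
upper triangular with diagonal blocks 1 and deflate A. *)
Lemma deflate_conj (R : comNzRingType) (m : nat) (A : 'M[R]_(1 + m)) :
  A *m const_mx 1 = const_mx 1 :> 'cV_(1 + m) ->
  A *m block_mx 1%:M 0 (const_mx 1) 1%:M =
    block_mx 1%:M 0 (const_mx 1) 1%:M *m block_mx 1%:M (ursubmx A) 0 (deflate A).
Proof.
move=> A1; rewrite -[A in LHS](submxK A) !mulmx_block.
rewrite !mulmx1 !mul1mx !mulmx0 !mul0mx !addr0 !add0r /deflate.
have A1' : ulsubmx A + ursubmx A *m const_mx 1 = 1%:M /\
    dlsubmx A + drsubmx A *m const_mx 1 = const_mx 1 :> 'cV_m.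
  move: A1; rewrite -[A in A *m _](submxK A).
  have -> : const_mx 1 = col_mx 1%:M (const_mx 1) :> 'cV[R]_(1 + m).
    rewrite -(col_mx_const 1); congr col_mx; apply/matrixP => i j.
    by rewrite !mxE !ord1.
  by rewrite mul_block_col !mulmx1 => /eq_col_mx.
by case: A1' => -> ->; rewrite subrKC.
Qed.

Lemma char_poly_deflate (R : comNzRingType) (m : nat) (A : 'M[R]_(1 + m)) :
  A *m const_mx 1 = const_mx 1 :> 'cV_(1 + m) ->
  char_poly A = ('X - 1) * char_poly (deflate A).
Proof.
move=> A1.
pose S : 'M[R]_(1 + m) := block_mx 1%:M 0 (const_mx 1) 1%:M.
pose B : 'M[R]_(1 + m) := block_mx 1%:M (ursubmx A) 0 (deflate A).
have detS : \det (map_mx (@polyC R) S) = 1.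
  by rewrite det_map_mx det_lblock !det1 mulr1.
have E : char_poly_mx A *m map_mx (@polyC R) S =
    map_mx (@polyC R) S *m char_poly_mx B.
  rewrite mulmxBl mulmxBr -!map_mxM /= deflate_conj //.
  by rewrite scalar_mxC.
have := congr1 determinant E; rewrite !det_mulmx detS mulr1 mul1r -!/(char_poly _).
move=> ->; rewrite /char_poly /char_poly_mx.
rewrite map_block_mx scalar_mx_block opp_block_mx add_block_mx.
rewrite map_mx0 subr0 det_ublock det_mx11 !mxE eqxx !mulr1n; congr (_ * _).
Qed.

(** Eigenvalues of deflate A are eigenvalues of A with a left eigenvector of
zero sum; this includes the eigenvalue 1 when it is multiple in A. *)
Lemma deflate_eigenvector (F : fieldType) (m : nat) (A : 'M[F]_(1 + m)) (l : F) :
  A *m const_mx 1 = const_mx 1 :> 'cV_(1 + m) ->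
  root (char_poly (deflate A)) l ->
  exists v : 'rV_(1 + m),
    [/\ v != 0, v *m A = l *: v & v *m const_mx 1 = 0 :> 'M_1].
Proof.
move=> A1; rewrite -eigenvalue_root_char => /eigenvalueP[w wA w0].
exists (row_mx (- (w *m const_mx 1)) w); split.
- by apply: contraNneq w0; rewrite -row_mx0 => /eq_row_mx[_ ->].
- pose S' : 'M[F]_(1 + m) := block_mx 1%:M 0 (- const_mx 1) 1%:M.
  pose S : 'M[F]_(1 + m) := block_mx 1%:M 0 (const_mx 1) 1%:M.
  have SS' : S *m S' = 1%:M.
    rewrite mulmx_block !mulmx1 !mul1mx !mulmx0 !mul0mx !addr0 !add0r subrr.
    by rewrite -scalar_mx_block.
  have S'S : S' *m S = 1%:M by apply: mulmx1C.
  have -> : row_mx (- (w *m const_mx 1)) w = row_mx 0 w *m S'.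
    by rewrite mul_row_block !mul0mx !add0r mulmx1 mulmxN.
  rewrite scalemxAl -mulmxA -[A]mulmx1 -SS' (mulmxA A) deflate_conj //.
  rewrite !mulmxA -(mulmxA _ S') S'S mulmx1 mul_row_block.
  by rewrite !mul0mx mulmx0 !add0r wA scale_row_mx scaler0.
- rewrite -(col_mx_const 1) mul_row_col.
  have -> : const_mx 1 = 1%:M :> 'M[F]_1.
    by apply/matrixP=> i j; rewrite !mxE !ord1.
  by rewrite mulmx1 addNr.
Qed.

(** If the first entry of beta is 1, removing 1 from beta leaves the second one,
which is an eigenvalue of the deflated matrix; otherwise the first entry
itself is such an eigenvalue and dominates the second one. *)
Lemma spectrum_stochastic (R : realType) (m : nat) (A : 'M[R]_m) (beta : seq R)
    (c : R) :
  (1 < m)%N -> A *m const_mx 1 = const_mx 1 :> 'cV_m -> is_spectrum A beta ->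
  (forall l (v : 'rV_m), v != 0 -> v *m A = l *: v -> 0 <= l) ->
  (forall l (v : 'rV_m), v != 0 -> v *m A = l *: v ->
     v *m const_mx 1 = 0 :> 'M_1 -> l <= c) ->
  Num.max beta`_1 `|beta`_m.-1| <= c.
Proof.
case: m A => [//|m] A m1 A1 [cpA sb] nonneg small.
have szb : size beta = m.+1.
  by apply: succn_inj; rewrite -(size_prod_XsubC _ id) -cpA size_char_poly.
have A1' := @char_poly_deflate _ m A A1.
have b1 : 1 \in beta.
  by rewrite -root_prod_XsubC -cpA A1' rootM -polyC1 root_XsubC eqxx.
have rem_root b : b \in rem 1 beta -> root (char_poly (@deflate _ m A)) b.
  have : ('X - 1) * char_poly (@deflate _ m A) =
         ('X - 1) * \prod_(b <- rem 1 beta) ('X - b%:P).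
    by rewrite -A1' cpA (perm_big _ (perm_to_rem b1)) big_cons.
  move/mulfI => -> ; last by rewrite -polyC1 polyXsubC_eq0.
  by rewrite root_prod_XsubC.
have rem_le b : b \in rem 1 beta -> b <= c.
  move/rem_root => /(@deflate_eigenvector _ m A _ A1)[v [v0 vA v1]].
  exact: small vA v1.
have b_ge0 b : b \in beta -> 0 <= b.
  rewrite -root_prod_XsubC -cpA -eigenvalue_root_char => /eigenvalueP[v vA v0].
  exact: nonneg vA.
have sb' i j : (i <= j)%N -> (j < m.+1)%N -> beta`_j <= beta`_i.
  move=> ij jm; apply: (sorted_leq_nth (leT := >=%R)) => //.
  - by move=> x y z /[swap]; apply: le_trans.
  - by move=> x /=.
  - by rewrite inE szb (leq_ltn_trans ij).
  - by rewrite inE szb.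
have b1c : beta`_1 <= c.
  case: beta szb {b1 cpA b_ge0 A1'} sb sb' rem_le {rem_root} => [//|b0 [|b1 s]].
    by case: (m) m1.
  move=> _ _ sb' rem_le /=.
  move: rem_le => /=; have [_|_] := eqVneq b0 1.
    by apply; rewrite inE eqxx.
  move=> H; apply: (le_trans (y := b0)); last by apply: H; rewrite inE eqxx.
  exact: (sb' 0%N 1%N).
rewrite ge_max b1c ger0_norm /=; last by apply: b_ge0; rewrite mem_nth ?szb.
by apply: le_trans b1c; apply: sb'; rewrite -ltnS.
Qed.

(** * Sites in lexicographic order and cuts of the grid *)

(** Position of the site u, from 0 to n^2 - 1, in the lexicographic order where
the second coordinate is compared first:
neighbouring sites are at distance 1 or n in this order. *)
Definition site_index {n : nat} (u : site n) : nat := (u.2 * n + u.1)%N.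

Lemma site_index_lt (n : nat) (u : site n) : (site_index u < n ^ 2)%N.
Proof.
case: u => i j; have := ltn_ord i; have := ltn_ord j.
rewrite /site_index /=; nia.
Qed.

Lemma site_index_inj (n : nat) : injective (@site_index n).
Proof.
move=> [i j] [i' j']; rewrite /site_index /= => E.
have n0 : (0 < n)%N by case: n i {j i' j' E} => // -[].
have := congr1 (modn^~ n) E; have := congr1 (divn^~ n) E.
rewrite !divnMDl // !divn_small // !addn0 !modnMDl !modn_small //.
move=> /ord_inj -> /ord_inj ->.
by [].
Qed.

Definition site_ord {n : nat} (u : site n) : 'I_(n ^ 2) :=
  Ordinal (site_index_lt u).

Lemma site_ord_bij (n : nat) : bijective (@site_ord n).
Proof.
apply: inj_card_bij => [u v [/site_index_inj]//|].
by rewrite card_prod !card_ord mulnn.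
Qed.

(** The bonds of the grid, as pairs of sites: p.2 is next to p.1, with larger
first or second coordinate.  Each bond is oriented so as to be counted
once. *)
Definition bond {n : nat} (p : site n * site n) : bool :=
  (p.2.1 == p.1.1.+1 :> nat) && (p.2.2 == p.1.2) ||
  (p.2.1 == p.1.1) && (p.2.2 == p.1.2.+1 :> nat).

Lemma interactionE (R : realType) (n : nat) (x : config n) :
  interaction R x = \sum_(p | bond p) spin R (x p.1) * spin R (x p.2).
Proof.
rewrite (bigID (fun p : site n * site n => p.2.2 == p.1.2)) /=; congr (_ + _).
- rewrite exchange_big pair_bigA /=.
  rewrite (pair_big_dep xpredT
    (fun (a : site n) (i' : 'I_n) => i' == a.1.+1 :> nat)
    (fun (a : site n) (i' : 'I_n) =>
       spin R (x (a.1, a.2)) * spin R (x (i', a.2)))) /=.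
  rewrite (reindex_onto (fun p : site n * 'I_n => (p.1, (p.2, p.1.2)))
     (fun p : site n * site n => (p.1, p.2.1))) /=.
    apply: eq_big => [[[i j] i']|[[i j] i'] _] //=.
    by rewrite /bond /= !eqxx /= !andbT; have [->|_] := eqVneq i' i; lia.
  by move=> [[i j] [i' j']] /= /andP[_ /eqP ->].
- rewrite pair_bigA /=.
  rewrite (pair_big_dep xpredT
    (fun (a : site n) (j' : 'I_n) => j' == a.2.+1 :> nat)
    (fun (a : site n) (j' : 'I_n) =>
       spin R (x (a.1, a.2)) * spin R (x (a.1, j')))) /=.
  rewrite (reindex_onto (fun p : site n * 'I_n => (p.1, (p.1.1, p.2)))
     (fun p : site n * site n => (p.1, p.2.2))) /=.
    apply: eq_big => [[[i j] j']|[[i j] j'] _] //=.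
    rewrite /bond /= !eqxx /= !andbT.
    by have [->|] := eqVneq j' j; rewrite /= ?andbT ?andbF; lia.
  move=> [[i j] [i' j']]; rewrite /bond /= => /andP[/orP[/andP[_ ->]//|]].
  by case/andP=> /eqP ->.
Qed.

Lemma bond_index (n : nat) (p : site n * site n) : bond p ->
  site_index p.2 = (site_index p.1).+1 \/ site_index p.2 = (site_index p.1 + n)%N.
Proof.
case: p => [[i j] [i' j']]; rewrite /bond /site_index /=.
case/orP=> /andP[]; [move=> /eqP-> /eqP->|move=> /eqP-> /eqP->]; [left|right]; lia.
Qed.

(** The first site of such a pair has one of the d indices just below k. *)
Lemma card_index_shift (n k d : nat) : (0 < d)%N ->
  (#|[set p : site n * site n | [&& site_index p.2 == site_index p.1 + d,
      site_index p.1 < k & k <= site_index p.2]]| <= d)%N.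
Proof.
case: d => [//|d] _; rewrite -[leqRHS]card_ord.
apply: (@leq_card_in _ _ (fun p : site n * site n =>
  inord (k.-1 - site_index p.1) : 'I_d.+1)).
move=> [a b] [a' b']; rewrite !inE /=.
move=> /and3P[/eqP h1 h2 h3] /and3P[/eqP h4 h5 h6].
move/(congr1 val); rewrite /= !inordK; [|lia|lia] => E.
have E1 : site_index a = site_index a' by lia.
have E2 : site_index b = site_index b' by lia.
by rewrite (site_index_inj E1) (site_index_inj E2).
Qed.

(** The two sites of p are separated by the cut between the k first sites and
the others. *)
Definition cut {n : nat} (k : nat) (p : site n * site n) : bool :=
  (site_index p.1 < k)%N != (site_index p.2 < k)%N.

Lemma card_cut (n k : nat) : (0 < n)%N ->
  (#|[set p : site n * site n | bond p && cut k p]| <= n.+1)%N.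
Proof.
move=> n0; rewrite -add1n.
apply: leq_trans (leq_add (card_index_shift n k (ltn0Sn 0))
  (card_index_shift n k n0)).
apply: leq_trans (leq_card_setU _ _).
apply: subset_leq_card; apply/subsetP => p; rewrite !inE /cut.
move=> /andP[/bond_index]; lia.
Qed.

(** * The cost of cutting the grid in two *)

Section Cut.
Variables (R : realType) (n : nat).
Implicit Types (x y z w : config n) (u : site n).

(** The configuration equal to x on the k first sites and to y on the others;
mix k y x, for k from 0 to n^2, is the canonical path from x to y. *)
Definition mix (k : nat) x y : config n :=
  [ffun v => if (site_index v < k)%N then x v else y v].

(** The configuration x with its k first spins reversed. *)
Definition flip_below (k : nat) x : config n :=
  [ffun v => if (site_index v < k)%N then ~~ x v else x v].

(** The part of the interaction due to the bonds that do not cross the cut at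
k. *)
Definition inner (k : nat) x : R :=
  \sum_(p | bond p && ~~ cut k p) spin R (x p.1) * spin R (x p.2).

(** The part of the interaction due to the bonds that cross the cut at k. *)
Definition across (k : nat) x : R :=
  \sum_(p | bond p && cut k p) spin R (x p.1) * spin R (x p.2).

Lemma interaction_split k x : interaction R x = inner k x + across k x.
Proof. by rewrite interactionE (bigID (cut k)) /= addrC. Qed.

Lemma inner_mix k w z :
  inner k (mix k w z) + inner k (mix k z w) = inner k w + inner k z.
Proof.
rewrite -!big_split /=; apply: eq_bigr => p /andP[_]; rewrite /cut !ffunE negbK.
by move=> /eqP ->; case: ifP => // _; rewrite addrC.
Qed.

Lemma spinN b : spin R (~~ b) = - spin R b.
Proof. by case: b; rewrite /spin ?opprK. Qed.

(** The two cases are the reversal of one side of the cut and the reversal of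
all the spins. *)
Lemma inner_flip k k' x : (k' = k \/ n ^ 2 <= k')%N ->
  inner k (flip_below k' x) = inner k x.
Proof.
move=> kk'; apply: eq_bigr => p /andP[_]; rewrite /cut !ffunE negbK.
case: kk' => [->|k'n].
  by move=> /eqP ->; case: ifP => // _; rewrite !spinN mulrNN.
have lt u : (site_index u < k')%N := leq_trans (site_index_lt u) k'n.
by rewrite !lt !spinN mulrNN.
Qed.

Lemma across_flip k x : across k (flip_below k x) = - across k x.
Proof.
rewrite -sumrN; apply: eq_bigr => p /andP[_]; rewrite /cut !ffunE.
by do 2 case: ifP => //=; rewrite spinN ?mulNr ?mulrN.
Qed.

Lemma across_le k x : (0 < n)%N -> `|across k x| <= n.+1%:R.
Proof.
move=> n0; apply: le_trans (ler_norm_sum _ _ _) _.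
rewrite (eq_bigr (fun=> 1)) => [|p _]; last first.
  rewrite normrM /spin.
  by case: (x _) (x _) => -[]; rewrite ?normrN normr1 mulr1.
rewrite sumr_const ler_nat; apply: leq_trans (card_cut k n0).
by apply: eq_leq; apply: eq_card => p; rewrite !inE.
Qed.

Lemma flip_belowK k : involutive (flip_below k).
Proof.
move=> x; apply/ffunP => v; rewrite !ffunE.
by case: (_ < _)%N; rewrite ?negbK.
Qed.

Lemma sum_flip (k : nat) (F : config n -> R) :
  \sum_x F (flip_below k x) = \sum_x F x.
Proof. by rewrite [RHS](reindex_inj (can_inj (flip_belowK k))). Qed.

Variable T : R.
Hypotheses (n0 : (0 < n)%N) (T0 : 0 < T).

(** Pairing x with its reversal below k replaces the factor exp(c) of the
crossing energy by (exp(c) + exp(-c)) / 2, which is at least 1. *)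
Lemma sum_inner_le k :
  \sum_x expR (T^-1 * inner k x) <= partition_function n T.
Proof.
(* a + 1/a >= 2, where a is the exponential of the crossing energy *)
have le2 x : expR (T^-1 * inner k x) *+ 2 <=
    expR (T^-1 * interaction R x) +
    expR (T^-1 * interaction R (flip_below k x)).
  rewrite !(interaction_split k) inner_flip ?across_flip; last by left.
  rewrite !mulrDr mulrN !expRD -mulrDr -mulr_natr ler_wpM2l ?expR_ge0 //.
  set a := expR _; rewrite expRN -/a.
  have a0 : 0 < a by exact: expR_gt0.
  have : 0 <= (a - 1) ^+ 2 / a by rewrite divr_ge0 ?sqr_ge0 ?ltW.
  have -> : (a - 1) ^+ 2 / a = a + a^-1 - 2 by field; rewrite gt_eqF.
  by rewrite subr_ge0.
suff : (\sum_x expR (T^-1 * inner k x)) *+ 2 <= partition_function n T *+ 2.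
  by rewrite lerMn2r.
rewrite -sumrMnl; apply: (le_trans (ler_sum _ (fun x _ => le2 x))).
rewrite big_split /= (sum_flip k (fun x => expR (T^-1 * interaction R x))).
by rewrite mulr2n.
Qed.

(** Reversing all the spins exchanges the configurations with w u = b and the
others. *)
Lemma half_inner k u b :
  \sum_(w : config n | w u != b) expR (T^-1 * inner k w)
    <= 2^-1 * partition_function n T.
Proof.
have E : \sum_(w : config n | w u == b) expR (T^-1 * inner k w) =
    \sum_(w : config n | w u != b) expR (T^-1 * inner k w).
  rewrite [RHS](reindex_inj (can_inj (flip_belowK (n ^ 2)))) /=.
  apply: eq_big => w; rewrite ?ffunE ?site_index_lt.
    by case: (w u) b => -[].
  by rewrite inner_flip //; right.
have := sum_inner_le k; rewrite (bigID (fun w : config n => w u == b)) /= E.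
lra.
Qed.

(** In the exponent, the three crossing energies of mix k w z, mix k z w and z
are bounded by n + 1 each; that of w has been traded for its partition
function. *)
Lemma cut_bound k u z :
  \sum_(w : config n | w u != z u) ising T (mix k w z) * ising T (mix k z w)
    <= 2^-1 * expR (T^-1 * (3 * n.+1%:R)) * ising T z.
Proof.
have Z0 : 0 < partition_function n T.
  have := ising_gt0 T z; rewrite /ising pmulr_lgt0 ?expR_gt0 //.
  by rewrite invr_gt0.
set M := expR _; set Z := partition_function n T in Z0 *.
have term w : ising T (mix k w z) * ising T (mix k z w) <=
    (Z^-1 * M * ising T z) * expR (T^-1 * inner k w).
  rewrite /ising -/Z mulrACA.
  have -> : Z^-1 * M * (Z^-1 * expR (T^-1 * interaction R z)) *
     expR (T^-1 * inner k w) = Z^-1 * Z^-1 *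
     (M * expR (T^-1 * interaction R z) * expR (T^-1 * inner k w)) by ring.
  rewrite ler_wpM2l ?mulr_ge0 ?invr_ge0 ?(ltW Z0) //.
  rewrite /M -!expRD ler_expR -!mulrDr ler_pM2l ?invr_gt0 //.
  rewrite !(interaction_split k).
  have := inner_mix k w z.
  have := across_le k z n0; have := across_le k (mix k w z) n0.
  have := across_le k (mix k z w) n0.
  rewrite !ler_norml => /andP[_ h1] /andP[_ h2] /andP[h3 _] h4.
  lra.
apply: le_trans (ler_sum _ (fun w _ => term w)) _.
rewrite -mulr_sumr.
apply: le_trans (ler_wpM2l _ (half_inner k u (z u))) _.
  by rewrite !mulr_ge0 ?invr_ge0 ?(ltW Z0) ?expR_ge0 // ltW // ising_gt0.
rewrite -/Z le_eqVlt; apply/orP; left; apply/eqP; field.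
by rewrite gt_eqF.
Qed.
End Cut.

(** * The Gibbs sampler and its Dirichlet form *)

Lemma sqr_sum_le (R : realDomainType) (I : finType) (F : I -> R) :
  (\sum_i F i) ^+ 2 <= #|I|%:R * \sum_i F i ^+ 2.
Proof.
have : 0 <= \sum_i \sum_j (F i - F j) ^+ 2.
  by apply: sumr_ge0 => i _; apply: sumr_ge0 => j _; apply: sqr_ge0.
have -> : \sum_i \sum_j (F i - F j) ^+ 2 =
    2 * (#|I|%:R * \sum_i F i ^+ 2 - (\sum_i F i) ^+ 2).
  transitivity (\sum_i \sum_j (F i ^+ 2 + F j ^+ 2 - 2 * (F i * F j))).
    by apply: eq_bigr => i _; apply: eq_bigr => j _; ring.
  under eq_bigr => i _ do rewrite sumrB big_split /= sumr_const
    -mulr_sumr -mulr_sumr.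
  rewrite sumrB big_split /= sumr_const -mulr_sumr -mulr_suml sumrMnl.
  by rewrite -mulr_natl expr2; ring.
by rewrite pmulr_rge0 // subr_ge0.
Qed.

Section Poincare.
Variables (R : realType) (n : nat) (T : R).
Hypotheses (n0 : (0 < n)%N) (T0 : 0 < T).
Implicit Types (x y z w : config n) (u v : site n) (f : config n -> R).

(** The configuration x with the spin at u reversed. *)
Definition flip x u : config n := update x u (~~ x u).

Lemma flipE x u v : flip x u v = (if v == u then ~~ x u else x v).
Proof. by rewrite ffunE. Qed.

Lemma flipK u : involutive (flip^~ u).
Proof.
move=> x; apply/ffunP => v; rewrite !flipE eqxx negbK.
by case: eqVneq => // ->.
Qed.

Lemma update_flip x u b : b != x u -> update x u b = flip x u.
Proof. by rewrite /flip; case: b (x u) => -[]. Qed.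

Lemma update_id x u : update x u (x u) = x.
Proof. by apply/ffunP => v; rewrite ffunE; case: eqP => [->|]. Qed.

(** n^2 times the probability that the stationary chain jumps from x to
flip x u; see ising_cond_prob. *)
Definition conductance x u : R :=
  ising T x * ising T (flip x u) / (ising T x + ising T (flip x u)).

Lemma conductance_flip x u : conductance (flip x u) u = conductance x u.
Proof.
by rewrite /conductance flipK [X in X / _]mulrC [X in _ / X]addrC.
Qed.

Lemma sum_ising : \sum_(x : config n) ising T x = 1 :> R.
Proof.
rewrite -mulr_sumr mulVf // gt_eqF //.
have := ising_gt0 T [ffun _ : site n => true].
by rewrite /ising pmulr_lgt0 ?expR_gt0 // invr_gt0.
Qed.

(** The transition probabilities without case distinction on the distance: all
the terms vanish unless y is x or x with one spin reversed. *)
Lemma gibbsE x y : gibbs T x y =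
  (y == x)%:R * (1 - (n ^ 2)%:R^-1 * \sum_u cond_prob T u (~~ x u) x) +
  \sum_u (y == flip x u)%:R * ((n ^ 2)%:R^-1 * cond_prob T u (~~ x u) x).
Proof.
rewrite /gibbs; case: eqVneq => [/eqP/cards1P[u Du]|Dn].
  have xyu v : (x v != y v) = (v == u) by have /setP/(_ v) := Du; rewrite !inE.
  have yx : y = flip x u.
    apply/ffunP => v; rewrite flipE; have := xyu v.
    by case: (eqVneq v u) => [->|_]; [case: (x u) (y u) => -[]|move/negbFE/eqP].
  have ne : (y == x) = false.
    apply/eqP => yx'; have := xyu u; by rewrite yx' !eqxx.
  rewrite (eq_bigl _ _ xyu) big_pred1_eq ne mul0r add0r (bigD1 u) //=.
  rewrite {2}yx eqxx mul1r big1 ?addr0; last first.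
    move=> v vu; case: eqP => [E|_]; last by rewrite mul0r.
    have := xyu v; rewrite (negbTE vu) E flipE eqxx.
    by case: (x v).
  by rewrite yx flipE eqxx.
rewrite [X in _ = _ + X]big1 ?addr0; last first.
  move=> u _; case: eqP => [E|_]; last by rewrite mul0r.
  case/negP: Dn; apply/cards1P; exists u; apply/setP => v.
  by rewrite !inE E flipE; case: (eqVneq v u) => [->|];
    [case: (x u)|rewrite eqxx].
rewrite [y == x]eq_sym; case: eqP => _; last by rewrite mul0r.
by rewrite mul1r pair_bigA; congr (1 - _ * _); apply: eq_bigr => -[].
Qed.

Lemma gibbs_action x f :
  \sum_y gibbs T x y * f y = f x +
    (n ^ 2)%:R^-1 * \sum_u cond_prob T u (~~ x u) x * (f (flip x u) - f x).
Proof.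
have delta z (c : R) : \sum_y (y == z)%:R * c * f y = c * f z.
  rewrite (bigD1 z) //= eqxx mul1r big1 ?addr0 // => y /negbTE ->.
  by rewrite !mul0r.
under eq_bigr => y _ do rewrite gibbsE mulrDl.
rewrite big_split /= delta.
under [X in _ + X]eq_bigr => y _ do rewrite mulr_suml.
rewrite exchange_big /=; under [X in _ + X]eq_bigr => u _ do rewrite delta.
rewrite mulrBl mul1r -addrA; congr (_ + _).
rewrite -mulrA mulr_suml -mulrN -sumrN mulr_sumr mulr_sumr -big_split /=.
by apply: eq_bigr => u _; ring.
Qed.

Lemma gibbs_stochastic x : \sum_y gibbs T x y = 1 :> R.
Proof.
have := gibbs_action x (fun=> 1); under eq_bigr => y _ do rewrite mulr1.
by move=> ->; rewrite big1 ?mulr0 ?addr0 // => u _; rewrite subrr mulr0.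
Qed.

Lemma ising_cond_prob x u :
  ising T x * cond_prob T u (~~ x u) x = conductance x u.
Proof.
by rewrite /cond_prob negbK update_id -/(flip x u) /conductance mulrA
  [X in _ / X]addrC.
Qed.

(** 2 n^2 times the Dirichlet form of the Gibbs sampler; see dirichletE. *)
Definition dirichlet f : R :=
  \sum_u \sum_x conductance x u * (f (flip x u) - f x) ^+ 2.

Lemma sum_flip_at u f : \sum_x f (flip x u) = \sum_x f x.
Proof. by rewrite [RHS](reindex_inj (can_inj (flipK u))). Qed.

(** Summation by parts, from the symmetry of the conductances. *)
Lemma dirichletE f :
  \sum_x ising T x * f x * (f x - \sum_y gibbs T x y * f y) =
    (2 * (n ^ 2)%:R)^-1 * dirichlet f.
Proof.
have E u : \sum_x conductance x u * f x * (f x - f (flip x u)) =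
    2^-1 * \sum_x conductance x u * (f (flip x u) - f x) ^+ 2.
  set S := LHS.
  have : S + S = \sum_x conductance x u * (f (flip x u) - f x) ^+ 2.
    rewrite {1}/S -(sum_flip_at u) -big_split; apply: eq_bigr => x _ /=.
    by rewrite conductance_flip flipK; ring.
  by move=> <-; rewrite -mulr2n -[S *+ 2]mulr_natl mulKf // pnatr_eq0.
rewrite invfM -mulrA mulrCA mulr_sumr.
under [X in _ = _ * X]eq_bigr => u _ do rewrite -E.
rewrite exchange_big mulr_sumr; apply: eq_bigr => x _ /=.
rewrite gibbs_action opprD addrA subrr add0r -mulrN mulrCA -sumrN mulr_sumr.
congr (_ * _); apply: eq_bigr => u _; rewrite -ising_cond_prob; ring.
Qed.

(** This is the nonnegativity of the Gibbs sampler: with p, q the weights of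
two configurations differing at one site and a, b the values of f there, it
amounts to (p a + q b)^2 >= 0. *)
Lemma dirichlet_le f :
  dirichlet f <= 2 * (n ^ 2)%:R * \sum_x ising T x * f x ^+ 2.
Proof.
have le u : \sum_x conductance x u * (f (flip x u) - f x) ^+ 2 <=
    2 * \sum_x ising T x * f x ^+ 2.
  rewrite mulr_natl mulr2n -{2}(sum_flip_at u (fun x => ising T x * f x ^+ 2)).
  rewrite -big_split; apply: ler_sum => x _ /=.
  rewrite /conductance; set p := ising T x; set q := ising T (flip x u).
  have p0 : 0 < p by exact: ising_gt0.
  have q0 : 0 < q by exact: ising_gt0.
  rewrite mulrAC ler_pdivrMr ?addr_gt0 //.
  have := sqr_ge0 (p * f x + q * f (flip x u)); nra.
apply: le_trans (ler_sum _ (fun u _ => le u)) _.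
rewrite sumr_const card_prod !card_ord mulnn.
rewrite -[X in X <= _]mulr_natl mulrCA mulrA.
exact: lexx.
Qed.

(** * The Poincare inequality by canonical paths *)

Lemma mixK k x y : mix k (mix k x y) (mix k y x) = x.
Proof. by apply/ffunP => v; rewrite !ffunE; case: (_ < _)%N. Qed.

Lemma mix0 x y : mix 0 x y = y.
Proof. by apply/ffunP => v; rewrite ffunE ltn0. Qed.

Lemma mix_all x y : mix (n ^ 2) x y = x.
Proof. by apply/ffunP => v; rewrite ffunE site_index_lt. Qed.

Lemma site_index_ltS u v :
  (site_index v < (site_index u).+1)%N =
  (v == u) || (site_index v < site_index u)%N.
Proof. by rewrite ltnS leq_eqVlt (inj_eq (@site_index_inj n)). Qed.

Lemma mixS u x y :
  mix (site_index u).+1 x y = update (mix (site_index u) x y) u (x u).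
Proof.
by apply/ffunP => v; rewrite !ffunE site_index_ltS; case: (eqVneq v u) => [->|].
Qed.

(** The congestion constant. *)
Local Notation M := (expR (T^-1 * (3 * n.+1%:R))).

(** The sum on the left is bounded with the cut just before u and, after
flipping both z and w at u, with the cut just after u. *)
Lemma congestion u z :
  \sum_(w : config n | w u != z u)
    ising T (mix (site_index u) w z) * ising T (mix (site_index u) z w)
  <= M * conductance z u.
Proof.
set S := leLHS; have le1 : S <= 2^-1 * M * ising T z by exact: cut_bound.
have le2 : S <= 2^-1 * M * ising T (flip z u).
  apply: le_trans (cut_bound n0 T0 (site_index u).+1 u (flip z u)).
  rewrite le_eqVlt; apply/orP; left; apply/eqP.
  rewrite [RHS](reindex_inj (can_inj (flipK u))) /=.
  apply: eq_big => w; first by rewrite !flipE eqxx; case: (w u) (z u) => -[].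
  move=> wz; congr (_ * _); congr (ising T _); apply/ffunP => v;
    rewrite !ffunE site_index_ltS;
    (have [->|//] := eqVneq v u); rewrite ltnn;
    by case: (w u) (z u) wz => -[].
move: le1 le2; rewrite /conductance.
set p := ising T z; set q := ising T (flip z u).
have p0 : 0 < p by exact: ising_gt0.
have q0 : 0 < q by exact: ising_gt0.
have M0 : 0 < M by exact: expR_gt0.
move=> le1 le2; rewrite mulrA ler_pdivlMr ?addr_gt0 // mulrDr.
apply: le_trans (lerD (ler_wpM2r (ltW p0) le2) (ler_wpM2r (ltW q0) le1)) _.
lra.
Qed.

Lemma poincare f :
  \sum_x \sum_y ising T x * ising T y * (f x - f y) ^+ 2
    <= (n ^ 2)%:R * M * dirichlet f.
Proof.
(* The increment of f along the path from x to y when the site u is updated. *)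
pose D u x y := f (mix (site_index u).+1 y x) - f (mix (site_index u) y x).
have tele x y : f y - f x = \sum_u D u x y.
  have [g gK Kg] := site_ord_bij n.
  rewrite (reindex g) /=; last by apply: onW_bij; exists (@site_ord n).
  transitivity (\sum_(0 <= k < n ^ 2) (f (mix k.+1 y x) - f (mix k y x))).
    by rewrite telescope_sumr // mix_all mix0.
  rewrite big_mkord; apply: eq_bigr => k _; rewrite /D.
  by have -> : site_index (g k) = k by have /(congr1 val) := Kg k.
have sqr x y : (f x - f y) ^+ 2 <= (n ^ 2)%:R * \sum_u D u x y ^+ 2.
  rewrite -[X in X <= _]sqrrN opprB tele.
  by have := sqr_sum_le (fun u => D u x y); rewrite card_prod !card_ord mulnn.
have step u : \sum_x \sum_y ising T x * ising T y * D u x y ^+ 2 <=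
    M * \sum_z conductance z u * (f (flip z u) - f z) ^+ 2.
  pose k := site_index u.
  rewrite pair_bigA /=.
  (* The change of variables from (x, y) to (z, w). *)
  rewrite (reindex_inj (h := fun p : config n * config n =>
     (mix k p.2 p.1, mix k p.1 p.2))); last first.
    apply: (can_inj (g := fun p => (mix k p.2 p.1, mix k p.1 p.2))) => -[z w].
    by rewrite /= !mixK.
  rewrite -(pair_bigA _ (fun z w => ising T (mix k w z) * ising T (mix k z w) *
     D u (mix k w z) (mix k z w) ^+ 2)) /= mulr_sumr.
  apply: ler_sum => z _.
  (* The step is trivial unless x and y, that is z and w, differ at u. *)
  have DE w : D u (mix k w z) (mix k z w) = f (update z u (w u)) - f z.
    rewrite /D mixS -/k !mixK; congr (f (update _ _ _) - _).
    by rewrite ffunE ltnn.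
  rewrite (bigID (fun w : config n => w u != z u)) /=.
  rewrite [X in _ + X]big1 ?addr0; last first.
    move=> w; rewrite negbK => /eqP wz.
    by rewrite DE wz update_id subrr expr0n mulr0.
  rewrite mulrA.
  apply: le_trans (ler_wpM2r (sqr_ge0 _) (congestion u z)).
  rewrite mulr_suml le_eqVlt; apply/orP; left; apply/eqP.
  by apply: eq_bigr => w wz; rewrite DE update_flip.
apply: (@le_trans _ _ ((n ^ 2)%:R *
    \sum_u \sum_x \sum_y ising T x * ising T y * D u x y ^+ 2)).
  rewrite [X in _ <= _ * X]exchange_big mulr_sumr; apply: ler_sum => x _ /=.
  rewrite [X in _ <= _ * X]exchange_big mulr_sumr; apply: ler_sum => y _ /=.
  by rewrite -mulr_sumr [leRHS]mulrCA ler_wpM2l // mulr_ge0 // ltW ?ising_gt0.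
rewrite -mulrA ler_wpM2l // /dirichlet mulr_sumr.
by apply: ler_sum => u _; exact: step.
Qed.

(** The double sum is twice the variance of f. *)
Lemma variance f : \sum_x ising T x * f x = 0 ->
  \sum_x \sum_y ising T x * ising T y * (f x - f y) ^+ 2 =
  2 * \sum_x ising T x * f x ^+ 2.
Proof.
move=> f0; transitivity (\sum_x (ising T x * f x ^+ 2 +
    ising T x * \sum_y ising T y * f y ^+ 2)); last first.
  by rewrite big_split /= -[X in _ + X]mulr_suml sum_ising; ring.
apply: eq_bigr => x _.
transitivity (\sum_y (ising T x * f x ^+ 2 * ising T y +
   ising T x * (ising T y * f y ^+ 2) - 2 * ising T x * f x * (ising T y * f y))).
  by apply: eq_bigr => y _; ring.
rewrite sumrB big_split /= -[X in X + _ - _]mulr_sumr.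
rewrite -[X in _ + X - _]mulr_sumr -[X in _ - X]mulr_sumr.
by rewrite f0 sum_ising mulr1 mulr0 subr0.
Qed.

Lemma norm2_gt0 f x : f x != 0 -> 0 < \sum_y ising T y * f y ^+ 2.
Proof.
move=> fx; rewrite (bigD1 x) //= ltr_pwDl //.
  by rewrite mulr_gt0 ?ising_gt0 // exprn_even_gt0.
by apply: sumr_ge0 => y _; rewrite mulr_ge0 ?sqr_ge0 // ltW ?ising_gt0.
Qed.

(** * The spectral gap *)

Variables (l : R) (f : config n -> R).
Hypothesis fP : forall x, \sum_y gibbs T x y * f y = l * f x.
Hypothesis f_neq0 : exists x, f x != 0.

Lemma eigen_dirichlet :
  (1 - l) * \sum_x ising T x * f x ^+ 2 = (2 * (n ^ 2)%:R)^-1 * dirichlet f.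
Proof.
rewrite -dirichletE mulr_sumr; apply: eq_bigr => x _; rewrite fP; ring.
Qed.

Lemma eigenvalue_ge0 : 0 <= l.
Proof.
have [x fx] := f_neq0; have S0 := norm2_gt0 fx.
have N0 : 0 < (2 * (n ^ 2)%:R : R) by rewrite mulr_gt0 // ltr0n expn_gt0 n0.
have := dirichlet_le f; rewrite -ler_pdivrMl // -eigen_dirichlet.
by rewrite ger_pMl // lerBlDr lerDl.
Qed.

Lemma eigenvalue_gap : \sum_x ising T x * f x = 0 ->
  l <= 1 - ((n ^ 2)%:R ^+ 2 * M)^-1.
Proof.
move=> f0; have [x fx] := f_neq0; have S0 := norm2_gt0 fx.
have N0 : 0 < ((n ^ 2)%:R : R) by rewrite ltr0n expn_gt0 n0.
have := poincare f; rewrite variance //.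
have -> : dirichlet f = 2 * (n ^ 2)%:R * ((1 - l) * \sum_x ising T x * f x ^+ 2).
  by rewrite eigen_dirichlet mulVKf // mulf_neq0 // gt_eqF.
set S := \sum_x _ in S0 *; set N := (n ^ 2)%:R in N0 *.
have -> : N * M * (2 * N * ((1 - l) * S)) = 2 * (N ^+ 2 * M * (1 - l)) * S by ring.
rewrite ler_pM2r // -[X in X <= _]mulr1 ler_pM2l // => h.
rewrite lerBrDr -lerBrDl -[X in X <= _]mul1r ler_pdivrMr; last first.
  by rewrite mulr_gt0 ?expR_gt0 // exprn_gt0.
by rewrite mulrC.
Qed.
End Poincare.

(** By reversibility, the density with respect to the Ising distribution of a
left eigenvector is a right eigenvector. *)
Lemma eigenvector_density (R : realType) (n : nat) (T l : R)
    (v : 'rV_#|config n|) (f : config n -> R) :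
  (forall x, v ord0 (enum_rank x) = ising T x * f x) ->
  v *m gibbs_mx n T = l *: v ->
  forall x, \sum_y gibbs T x y * f y = l * f x.
Proof.
move=> vf vA x; have /rowP/(_ (enum_rank x)) := vA; rewrite !mxE vf => E.
have p0 : ising T x != 0 by rewrite gt_eqF ?ising_gt0.
apply: (mulfI p0); rewrite mulrCA -E mulr_sumr.
rewrite (reindex (@enum_rank _)) /=; last exact/onW_bij/enum_rank_bij.
apply: eq_bigr => y _; rewrite vf mxE !enum_rankK mulrA gibbs_reversible; ring.
Qed.

Theorem corollary1 (R : realType) (n : nat) (T : R) (beta : seq R) :
  (1 <= n)%N -> 0 < T ->
  is_spectrum (gibbs_mx n T) beta ->
  beta_star n beta
    <= 1 - n%:R ^- 4 * expR (- (2 / T * (2 * n%:R + 1))).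
Proof.
move=> n1 T0 spec.
have card_gt1 : (1 < #|config n|)%N.
  rewrite card_ffun card_bool card_prod !card_ord.
  by rewrite -{1}(expn0 2) ltn_exp2l // muln_gt0 n1.
have P1 : gibbs_mx n T *m const_mx 1 = const_mx 1 :> 'cV_#|config n|.
  apply/matrixP => i j; rewrite !mxE -[RHS](gibbs_stochastic T (enum_val i)).
  rewrite (reindex (@enum_rank _)) /=; last exact/onW_bij/enum_rank_bij.
  by apply: eq_bigr => y _; rewrite !mxE enum_rankK mulr1.
have density (v : 'rV[R]_#|config n|) : exists f : config n -> R,
    forall x, v ord0 (enum_rank x) = ising T x * f x.
  exists (fun x => v ord0 (enum_rank x) / ising T x) => x.
  by rewrite mulrC divfK // gt_eqF ?ising_gt0.
have neq0 (v : 'rV[R]_#|config n|) (f : config n -> R) : v != 0 ->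
    (forall x, v ord0 (enum_rank x) = ising T x * f x) -> exists x, f x != 0.
  move=> v0 vf; apply/existsP; apply: contraNT v0 => /existsPn f0.
  apply/eqP/rowP => i; rewrite mxE -(enum_valK i) vf.
  by have := f0 (enum_val i); rewrite negbK => /eqP ->; rewrite mulr0.
apply: spectrum_stochastic card_gt1 P1 spec _ _ => l v v0 vA.
  have [f vf] := density v.
  exact: (eigenvalue_ge0 n1 (eigenvector_density vf vA) (neq0 _ _ v0 vf)).
move=> v1; have [f vf] := density v.
have f0 : \sum_x ising T x * f x = 0.
  have /matrixP/(_ ord0 ord0) := v1; rewrite !mxE.
  rewrite (reindex (@enum_rank _)) /=; last exact/onW_bij/enum_rank_bij.
  by move=> E; rewrite -[RHS]E; apply: eq_bigr => x _; rewrite mxE mulr1 vf.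
apply: le_trans (eigenvalue_gap n1 T0 (eigenvector_density vf vA)
  (neq0 _ _ v0 vf) f0) _.
rewrite lerB // natrX -exprM [leRHS]invfM -[X in _ <= _ * X]expRN.
rewrite ler_wpM2l ?invr_ge0 ?exprn_ge0 //.
have Ti : 0 < T^-1 by rewrite invr_gt0.
have n1' : 1 <= n%:R :> R by rewrite ler1n.
(* 3 (n + 1) <= 2 (2 n + 1) *)
rewrite ler_expR lerN2 [2 / T]mulrC -mulrA ler_pM2l // -[n.+1]addn1 natrD; lra.
Qed.
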